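(* Let $(u_1,u_2)$ be parabolic coordinates on the plane with conjugate momenta $(p_{u_1},p_{u_2})$. The geodesic flow with the metric, diagonal in parabolic coordinates, $$\hat{\mathrm g}^{(km)}=\begin{pmatrix}\dfrac{(ku_1+u_2)u_1^m}{u_1-u_2}&0\\[2mm]0&\dfrac{(ku_2+u_1)u_2^m}{u_2-u_1}\end{pmatrix},$$ that is, with Hamiltonian $$T=\frac{(ku_1+u_2)u_1^m}{u_1-u_2}\,p_{u_1}^2+\frac{(ku_2+u_1)u_2^m}{u_2-u_1}\,p_{u_2}^2,$$ is integrable for $k=3$, $m=3,4$, and for $k=2$, $m=1$. The corresponding integrals of motion are $$K=(u_1^2p_{u_1}-u_2^2p_{u_2})\cdot\frac{u_1^{m/2}u_2^{m/2}\,(u_1^mp_{u_1}^2-u_2^mp_{u_2}^2)}{(u_1-u_2)^2}\qquad\text{for } k=3,\ m=3,4,$$ and $$K=(u_1^2p_{u_1}-u_2^2p_{u_2})\cdot\frac{u_1^{m}u_2^{m}\,(p_{u_1}-p_{u_2})^2}{(u_1-u_2)^3}\qquad\text{for } k=2,\ m=1;$$ they are polynomials of third order in the momenta with the common factor $u_1^2p_{u_1}-u_2^2p_{u_2}$.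
   Context: The Poisson bracket on $T^*\mathbb R^2$ is canonical: $\{u_i,p_{u_j}\}=\delta_{ij}$, $\{u_1,u_2\}=\{p_{u_1},p_{u_2}\}=0$. Parabolic coordinates on the plane with Cartesian coordinates $(q_1,q_2)$ are $u_1=q_2-\sqrt{q_1^2+q_2^2}$, $u_2=q_2+\sqrt{q_1^2+q_2^2}$. $K$ being an integral of motion means $\{T,K\}=0$; integrable means that $T$ and $K$ are independent integrals in involution. All formulas are understood where they are defined ($u_1\ne u_2$, and for $m=3$ with a fixed local branch of $u_1^{3/2}u_2^{3/2}$). *)

(* Defs.v *)
From Stdlib Require Import Reals Lra.
From Coquelicot Require Import Coquelicot.
Open Scope R_scope.

Notation plane := (R * R)%type.

(* A point of T^*R^2 in canonical coordinates: ((x1, x2), (y1, y2)), with y_i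
   the momentum conjugate to x_i.  Observables are complex-valued, since
   u1^(3/2) u2^(3/2) is imaginary where u1 u2 < 0, in particular over the whole
   range u1 <= 0 <= u2 of the parabolic coordinates. *)
Notation phase := ((R * R) * (R * R))%type.

Record gradient : Type := Gradient { d_x1 : C; d_x2 : C; d_y1 : C; d_y2 : C }.

Definition is_gradient (F : phase -> C) (z : phase) (g : gradient) : Prop :=
  let '((x1, x2), (y1, y2)) := z in
  is_derive (fun t : R => F ((t, x2), (y1, y2))) x1 (d_x1 g) /\
  is_derive (fun t : R => F ((x1, t), (y1, y2))) x2 (d_x2 g) /\
  is_derive (fun t : R => F ((x1, x2), (t, y2))) y1 (d_y1 g) /\
  is_derive (fun t : R => F ((x1, x2), (y1, t))) y2 (d_y2 g).

(* Canonical bracket, normalised by {x_i, y_j} = delta_ij. *)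
Definition poisson (g h : gradient) : C :=
  ((d_x1 g * d_y1 h - d_y1 g * d_x1 h) +
   (d_x2 g * d_y2 h - d_y2 g * d_x2 h))%C.

Definition in_involution (Omega : phase -> Prop) (F G : phase -> C) : Prop :=
  forall z, Omega z ->
    exists g h : gradient,
      is_gradient F z g /\ is_gradient G z h /\ poisson g h = RtoC 0.

Definition lin_indep (g h : gradient) : Prop :=
  forall a b : C,
    (a * d_x1 g + b * d_x1 h)%C = RtoC 0 ->
    (a * d_x2 g + b * d_x2 h)%C = RtoC 0 ->
    (a * d_y1 g + b * d_y1 h)%C = RtoC 0 ->
    (a * d_y2 g + b * d_y2 h)%C = RtoC 0 ->
    a = RtoC 0 /\ b = RtoC 0.

(* The differentials are linearly independent on a dense subset of Omega; they
   cannot be so everywhere, as both vanish on the zero section. *)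
Definition independent (Omega : phase -> Prop) (F G : phase -> C) : Prop :=
  forall z, Omega z -> forall P : phase -> Prop, locally z P ->
    exists z' : phase, Omega z' /\ P z' /\
      exists g h : gradient,
        is_gradient F z' g /\ is_gradient G z' h /\ lin_indep g h.

Definition integrable (Omega : phase -> Prop) (T K : phase -> C) : Prop :=
  in_involution Omega T K /\ independent Omega T K.

Definition u1_of (q : plane) : R := snd q - sqrt (fst q ^ 2 + snd q ^ 2).
Definition u2_of (q : plane) : R := snd q + sqrt (fst q ^ 2 + snd q ^ 2).

(* From Cartesian (q, p_q) to parabolic (u, p_u), for q1 <> 0:
   p_{u_i} = p_{q1} dq1/du_i + p_{q2} dq2/du_i, where q1^2 = - u1 u2 and
   q2 = (u1 + u2) / 2. *)
Definition parabolic_lift (z : phase) : phase :=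
  let '(q, (p1, p2)) := z in
  ((u1_of q, u2_of q),
   ((p2 - u2_of q / fst q * p1) / 2, (p2 - u1_of q / fst q * p1) / 2)).

(* The lift preserves the tautological form:
   p_{u1} du1 + p_{u2} du2 = p_{q1} dq1 + p_{q2} dq2. *)
Lemma parabolic_lift_conjugate (q1 q2 p1 p2 : R) :
  q1 <> 0 ->
  exists a11 a12 a21 a22 : R,
    is_derive (fun t => u1_of (t, q2)) q1 a11 /\
    is_derive (fun t => u1_of (q1, t)) q2 a12 /\
    is_derive (fun t => u2_of (t, q2)) q1 a21 /\
    is_derive (fun t => u2_of (q1, t)) q2 a22 /\
    let pu := snd (parabolic_lift ((q1, q2), (p1, p2))) in
    p1 = fst pu * a11 + snd pu * a21 /\
    p2 = fst pu * a12 + snd pu * a22.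
Proof.
intros Hq.
assert (Hpos : 0 < q1 ^ 2 + q2 ^ 2).
{ assert (0 < q1 ^ 2) by (rewrite <- Rsqr_pow2; now apply Rlt_0_sqr).
  pose proof (pow2_ge_0 q2); lra. }
pose proof (sqrt_lt_R0 _ Hpos) as Hr.
exists (- (q1 / sqrt (q1 ^ 2 + q2 ^ 2))), (1 - q2 / sqrt (q1 ^ 2 + q2 ^ 2)),
  (q1 / sqrt (q1 ^ 2 + q2 ^ 2)), (1 + q2 / sqrt (q1 ^ 2 + q2 ^ 2)).
unfold parabolic_lift, u1_of, u2_of; cbn [fst snd].
split; [| split; [| split; [| split; [| split]]]].
all: try (auto_derive; [ simpl in Hpos; lra | ]).
all: simpl in Hr |- *.
all: match goal with |- ?a = ?b => change (@eq R a b) end.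
all: field; lra.
Qed.

Definition cartesian_domain (D : plane -> Prop) (z : phase) : Prop :=
  fst (fst z) <> 0 /\ D (fst (parabolic_lift z)).

(* Integrability over the domain D of the (u1, u2)-plane, both in the canonical
   coordinates (u, p_u) themselves and, through u = u(q), in the Cartesian
   canonical coordinates (q, p_q) of T^*R^2.  In the former D may contain points
   outside the range of the map q |-> u. *)
Definition integrable_parabolic (D : plane -> Prop) (T K : phase -> C) : Prop :=
  integrable (fun z => D (fst z)) T K /\
  integrable (cartesian_domain D)
    (fun z => T (parabolic_lift z)) (fun z => K (parabolic_lift z)).

(* Contravariant components of the metric. *)
Definition metric (k : R) (m : nat) (u : plane) : matrix 2 2 :=
  let '(u1, u2) := u in
  [[ (k * u1 + u2) * u1 ^ m / (u1 - u2), 0 ],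
   [ 0, (k * u2 + u1) * u2 ^ m / (u2 - u1) ]].

Definition geodesic_hamiltonian (g : plane -> matrix 2 2) (z : phase) : C :=
  let '(u, (p1, p2)) := z in
  let c := coeff_mat 0 (g u) in
  RtoC (c 0%nat 0%nat * p1 ^ 2 + c 0%nat 1%nat * p1 * p2
        + c 1%nat 0%nat * p2 * p1 + c 1%nat 1%nat * p2 ^ 2).

Definition common_factor (z : phase) : C :=
  let '((u1, u2), (p1, p2)) := z in RtoC (u1 ^ 2 * p1 - u2 ^ 2 * p2).

(* [w] stands for u1^(m/2) u2^(m/2). *)
Definition K3 (m : nat) (w : plane -> C) (z : phase) : C :=
  let '((u1, u2), (p1, p2)) := z in
  (common_factor z *
   (w (u1, u2) * RtoC ((u1 ^ m * p1 ^ 2 - u2 ^ m * p2 ^ 2) / (u1 - u2) ^ 2)))%C.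

Definition K2 (m : nat) (z : phase) : C :=
  let '((u1, u2), (p1, p2)) := z in
  (common_factor z *
   RtoC (u1 ^ m * u2 ^ m * (p1 - p2) ^ 2 / (u1 - u2) ^ 3))%C.

Definition off_diagonal (u : plane) : Prop := fst u <> snd u.

(* A local branch on D of u1^(3/2) u2^(3/2): a continuous square root of
   u1^3 u2^3, away from the branch locus u1 u2 = 0. *)
Definition is_branch_3_2 (D : plane -> Prop) (s : plane -> C) : Prop :=
  open D /\
  forall u : plane, D u ->
    fst u <> 0 /\ snd u <> 0 /\ continuous s u /\
    (s u * s u)%C = RtoC (fst u ^ 3 * snd u ^ 3).

Definition homogeneous_in_momenta
    (D : plane -> Prop) (d : nat) (F : phase -> C) : Prop :=
  exists c : nat -> plane -> C,
    forall (u : plane) (p1 p2 : R), D u ->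
      F (u, (p1, p2)) =
      sum_n (fun i => (c i u * RtoC (p1 ^ i * p2 ^ (d - i)))%C) d.

Definition has_momentum_factor
    (D : plane -> Prop) (d : nat) (L F : phase -> C) : Prop :=
  exists Q : phase -> C,
    homogeneous_in_momenta D d Q /\
    forall z : phase, D (fst z) -> F z = (L z * Q z)%C.

(* K is not identically zero on any open set, by independence of T and K, so
   its order in the momenta is exactly 3. *)
Definition integrable_by_cubic
    (D : plane -> Prop) (T K : phase -> C) : Prop :=
  integrable_parabolic D T K /\
  homogeneous_in_momenta D 3 K /\
  has_momentum_factor D 2 common_factor K.

(* Main.v *)
Require Import Defs.
From Stdlib Require Import Reals Lra.
From Coquelicot Require Import Coquelicot.
Open Scope R_scope.

(** Locally K is a complex constant times a real observable: a branch of
    u1^(3/2) u2^(3/2) is a constant times sqrt |u1^3 u2^3|.  So everything reduces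
    to real differentials, and {T, K} = 0 is a rational identity, in which the
    factor u1^(m/2) u2^(m/2) enters only through its logarithmic derivatives
    m / (2 u_i).  The lift to Cartesian coordinates is canonical and hence
    preserves brackets.  For independence we use the minor of the
    momentum derivatives of T and K: it is a cubic in p_{u1} whose leading
    coefficient vanishes only where u1 u2 (k u1 + u2) = 0, so it is nonzero on a
    dense set. *)

(** * Differentials along curves, for real and complex observables *)

Definition pairing (g v : phase) : R :=
  fst (fst g) * fst (fst v) + snd (fst g) * snd (fst v) +
  fst (snd g) * fst (snd v) + snd (snd g) * snd (snd v).

Definition is_velocity (x1 x2 y1 y2 : R -> R) (t : R) (v : phase) : Prop :=
  is_derive x1 t (fst (fst v)) /\ is_derive x2 t (snd (fst v)) /\
  is_derive y1 t (fst (snd v)) /\ is_derive y2 t (snd (snd v)).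

(* Differentiability along curves, which makes the chain rule through
   [parabolic_lift] a substitution. *)
Definition has_differential (f : phase -> R) (z g : phase) : Prop :=
  forall x1 x2 y1 y2 t v,
    is_velocity x1 x2 y1 y2 t v -> ((x1 t, x2 t), (y1 t, y2 t)) = z ->
    is_derive (fun s => f ((x1 s, x2 s), (y1 s, y2 s))) t (pairing g v).

(** The differential is one complex constant times a real covector. This shape reduces brackets and
    independence to real computations on [g]. *)
Definition has_Cdifferential (F : phase -> C) (z : phase) (c : C) (g : phase)
    : Prop :=
  forall x1 x2 y1 y2 t v,
    is_velocity x1 x2 y1 y2 t v -> ((x1 t, x2 t), (y1 t, y2 t)) = z ->
    is_derive (fun s => F ((x1 s, x2 s), (y1 s, y2 s))) t
      (c * RtoC (pairing g v))%C.

Lemma is_velocity_Derive (x1 x2 y1 y2 : R -> R) (t : R) (v : phase) :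
  is_velocity x1 x2 y1 y2 t v ->
  (ex_derive x1 t /\ ex_derive x2 t /\ ex_derive y1 t /\ ex_derive y2 t) /\
  Derive x1 t = fst (fst v) /\ Derive x2 t = snd (fst v) /\
  Derive y1 t = fst (snd v) /\ Derive y2 t = snd (snd v).
Proof.
intros (H1 & H2 & H3 & H4).
repeat split; solve [ eexists; eassumption | apply is_derive_unique; assumption ].
Qed.

Definition Cgradient (c : C) (g : phase) : gradient :=
  Gradient (c * RtoC (fst (fst g))) (c * RtoC (snd (fst g)))
           (c * RtoC (fst (snd g))) (c * RtoC (snd (snd g))).

Definition real_poisson (g h : phase) : R :=
  fst (fst g) * fst (snd h) - fst (snd g) * fst (fst h) +
  (snd (fst g) * snd (snd h) - snd (snd g) * snd (fst h)).

Definition momentum_minor (g h : phase) : R :=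
  fst (snd g) * snd (snd h) - snd (snd g) * fst (snd h).

Lemma is_derive_Cscal (c : C) (f : R -> R) (t l : R) :
  is_derive f t l -> is_derive (fun s => (c * RtoC (f s))%C) t (c * RtoC l)%C.
Proof.
intros H.
pose proof (is_derive_scal_l (V := prod_NormedModule R_AbsRing R_NormedModule R_NormedModule) f t l c H) as H1.
assert (E : forall x, scal (V := prod_NormedModule R_AbsRing R_NormedModule R_NormedModule) x c = (c * RtoC x)%C).
{ intros x. apply injective_projections; simpl; unfold scal; simpl;
  unfold mult; simpl; ring. }
rewrite <- E.
eapply is_derive_ext; [| exact H1].
intros s; apply E.
Qed.

Lemma locally_curve (x1 x2 y1 y2 : R -> R) (t : R) (v z : phase)
    (P : phase -> Prop) :
  is_velocity x1 x2 y1 y2 t v -> ((x1 t, x2 t), (y1 t, y2 t)) = z ->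
  locally z P -> locally t (fun s => P ((x1 s, x2 s), (y1 s, y2 s))).
Proof.
intros (H1 & H2 & H3 & H4) <- [eps HP].
assert (Hc : forall (x : R -> R) l, is_derive x t l ->
  locally t (fun s => ball (x t) eps (x s))).
{ intros x l H.
  apply (proj1 (filterlim_locally (U := R_UniformSpace) (F := locally (T := R_UniformSpace) t) x (x t))).
  apply (ex_derive_continuous (V := R_NormedModule)); exists l; exact H. }
generalize (filter_and _ _ (filter_and _ _ (Hc _ _ H1) (Hc _ _ H2))
  (filter_and _ _ (Hc _ _ H3) (Hc _ _ H4))).
apply filter_imp; intros s [[B1 B2] [B3 B4]].
apply HP; repeat split; assumption.
Qed.

(** A derivative along a curve sees [F] only near [z], so the constant [c] may change from point to
    point. This is what allows a complex branch to be replaced by a real root. *)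
Lemma has_Cdifferential_loc (F : phase -> C) (f : phase -> R) (z g : phase)
    (c : C) :
  locally z (fun z' => F z' = (c * RtoC (f z'))%C) ->
  has_differential f z g -> has_Cdifferential F z c g.
Proof.
intros HF Hf x1 x2 y1 y2 t v Hv Hz.
apply (is_derive_ext_loc (fun s => (c * RtoC (f ((x1 s, x2 s), (y1 s, y2 s))))%C)).
- generalize (locally_curve _ _ _ _ _ _ _ _ Hv Hz HF).
  apply filter_imp; intros s E; symmetry; exact E.
- apply is_derive_Cscal, Hf; assumption.
Qed.

(** The four coordinate lines are curves whose velocities are the basis vectors. *)
Lemma has_Cdifferential_gradient (F : phase -> C) (z : phase) (c : C)
    (g : phase) :
  has_Cdifferential F z c g -> is_gradient F z (Cgradient c g).
Proof.
destruct z as [[x1 x2] [y1 y2]]; intros H.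
assert (Hid : forall x : R, is_derive (fun t : R => t) x 1)
  by (intros; auto_derive; auto).
assert (Hcst : forall a x : R, is_derive (fun _ : R => a) x 0)
  by (intros; auto_derive; auto).
split; [| split; [| split]]; cbn [d_x1 d_x2 d_y1 d_y2 Cgradient].
- replace (fst (fst g)) with (pairing g ((1, 0), (0, 0)))
    by (unfold pairing; simpl; ring).
  refine (H (fun t => t) (fun _ => x2) (fun _ => y1) (fun _ => y2)
    x1 ((1, 0), (0, 0)) _ _);
    [split; [| split; [| split]]; simpl; auto | reflexivity].
- replace (snd (fst g)) with (pairing g ((0, 1), (0, 0)))
    by (unfold pairing; simpl; ring).
  refine (H (fun _ => x1) (fun t => t) (fun _ => y1) (fun _ => y2)
    x2 ((0, 1), (0, 0)) _ _);
    [split; [| split; [| split]]; simpl; auto | reflexivity].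
- replace (fst (snd g)) with (pairing g ((0, 0), (1, 0)))
    by (unfold pairing; simpl; ring).
  refine (H (fun _ => x1) (fun _ => x2) (fun t => t) (fun _ => y2)
    y1 ((0, 0), (1, 0)) _ _);
    [split; [| split; [| split]]; simpl; auto | reflexivity].
- replace (snd (snd g)) with (pairing g ((0, 0), (0, 1)))
    by (unfold pairing; simpl; ring).
  refine (H (fun _ => x1) (fun _ => x2) (fun _ => y1) (fun t => t)
    y2 ((0, 0), (0, 1)) _ _);
    [split; [| split; [| split]]; simpl; auto | reflexivity].
Qed.

(** * The cotangent lift from Cartesian to parabolic coordinates *)

(* The derivative of [parabolic_lift] at z in the direction v. *)
Definition lift_velocity (z : phase) (v : phase) : phase :=
  let '((q1, q2), (p1, p2)) := z in
  let '((a1, a2), (b1, b2)) := v in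
  let r := sqrt (q1 ^ 2 + q2 ^ 2) in
  let dr := (q1 * a1 + q2 * a2) / r in
  ((a2 - dr, a2 + dr),
   ((b2 - ((a2 + dr) / q1 - (q2 + r) * a1 / q1 ^ 2) * p1
        - (q2 + r) / q1 * b1) / 2,
    (b2 - ((a2 - dr) / q1 - (q2 - r) * a1 / q1 ^ 2) * p1
        - (q2 - r) / q1 * b1) / 2)).

(** The transposed Jacobian of the lift applied to [g], one component per basis direction. *)
Definition lift_pullback (z g : phase) : phase :=
  ((pairing g (lift_velocity z ((1, 0), (0, 0))),
    pairing g (lift_velocity z ((0, 1), (0, 0)))),
   (pairing g (lift_velocity z ((0, 0), (1, 0))),
    pairing g (lift_velocity z ((0, 0), (0, 1))))).

Lemma radius_pos (q1 q2 : R) : q1 <> 0 -> 0 < q1 ^ 2 + q2 ^ 2.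
Proof.
intros H; pose proof (pow2_gt_0 q1 H); pose proof (pow2_ge_0 q2); lra.
Qed.

Lemma has_Cdifferential_lift (F : phase -> C) (z : phase) (c : C) (g : phase) :
  fst (fst z) <> 0 ->
  has_Cdifferential F (parabolic_lift z) c g ->
  has_Cdifferential (fun z' => F (parabolic_lift z')) z c (lift_pullback z g).
Proof.
intros Hq H x1 x2 y1 y2 t v Hv <-.
cbn [fst] in Hq.
pose proof (radius_pos _ (x2 t) Hq) as Hr.
pose proof (sqrt_lt_R0 _ Hr) as Hs.
(* The pullback is adjoint to [lift_velocity] because the latter is linear in the direction. What
   remains is to check that the lifted curve has the velocity [lift_velocity]. *)
replace (pairing (lift_pullback ((x1 t, x2 t), (y1 t, y2 t)) g) v)
  with (pairing g (lift_velocity ((x1 t, x2 t), (y1 t, y2 t)) v)).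
2: { destruct g as [[g1 g2] [h1 h2]], v as [[a1 a2] [b1 b2]].
     unfold lift_pullback, pairing, lift_velocity.
     cbn [fst snd]. field. lra. }
refine (H (fun s => u1_of (x1 s, x2 s)) (fun s => u2_of (x1 s, x2 s))
  (fun s => (y2 s - u2_of (x1 s, x2 s) / x1 s * y1 s) / 2)
  (fun s => (y2 s - u1_of (x1 s, x2 s) / x1 s * y1 s) / 2) t _ _ _).
2: reflexivity.
unfold is_velocity, lift_velocity, u1_of, u2_of; cbn [fst snd].
destruct (is_velocity_Derive _ _ _ _ _ _ Hv)
  as [(X1 & X2 & X3 & X4) (E1 & E2 & E3 & E4)].
destruct v as [[a1 a2] [b1 b2]]; cbn [fst snd] in E1, E2, E3, E4.
simpl in Hr, Hs.
split; [| split; [| split]].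
all: auto_derive; [ repeat split; solve [ assumption | lra ] | ].
all: change (fun x => x1 x) with x1; change (fun x => x2 x) with x2;
  change (fun x => y1 x) with y1; change (fun x => y2 x) with y2;
  rewrite ?E1, ?E2, ?E3, ?E4; simpl.
all: match goal with |- ?a = ?b => change (@eq R a b) end.
all: field; lra.
Qed.

(** The Jacobian entries are rational in q, p and the radius r, so canonicity becomes a rational
    identity modulo [r ^ 2 = q1 ^ 2 + q2 ^ 2]. *)
Lemma real_poisson_lift (z g h : phase) :
  fst (fst z) <> 0 ->
  real_poisson (lift_pullback z g) (lift_pullback z h) = real_poisson g h.
Proof.
destruct z as [[q1 q2] [p1 p2]], g as [[g1 g2] [g3 g4]], h as [[h1 h2] [h3 h4]].
cbn [fst]; intros Hq.
pose proof (radius_pos _ q2 Hq) as Hr.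
pose proof (sqrt_lt_R0 _ Hr) as Hs.
pose proof (pow2_sqrt _ (Rlt_le _ _ Hr)) as E.
unfold real_poisson, lift_pullback, pairing, lift_velocity; cbn [fst snd].
revert Hs E; generalize (sqrt (q1 ^ 2 + q2 ^ 2)); intros r Hs E.
field [E]; lra.
Qed.

Lemma poisson_Cgradient (c d : C) (g h : phase) :
  real_poisson g h = 0 -> poisson (Cgradient c g) (Cgradient d h) = RtoC 0.
Proof.
intros H; unfold poisson; cbn [Cgradient d_x1 d_x2 d_y1 d_y2].
transitivity (c * d * RtoC (real_poisson g h))%C.
- unfold real_poisson.
  rewrite !RtoC_plus, !RtoC_minus, !RtoC_mult; ring.
- rewrite H; ring.
Qed.

(** Cramer's rule on the two momentum equations: eliminating [b] or [a] leaves the other coefficient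
    times a nonzero multiple of the minor. *)
Lemma lin_indep_Cgradient (c d : C) (g h : phase) :
  c <> RtoC 0 -> d <> RtoC 0 -> momentum_minor g h <> 0 ->
  lin_indep (Cgradient c g) (Cgradient d h).
Proof.
intros Hc Hd Hm a b _ _ E1 E2; cbn [Cgradient d_y1 d_y2] in E1, E2.
assert (Hm' : RtoC (momentum_minor g h) <> RtoC 0)
  by (intros E; apply Hm, RtoC_inj, E).
assert (Ha : (a * (c * RtoC (momentum_minor g h)))%C = RtoC 0).
{ transitivity ((a * (c * fst (snd g)) + b * (d * fst (snd h))) * RtoC (snd (snd h))
   - (a * (c * snd (snd g)) + b * (d * snd (snd h))) * RtoC (fst (snd h)))%C.
  - unfold momentum_minor; rewrite RtoC_minus, !RtoC_mult; ring.
  - rewrite E1, E2; ring. }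
assert (Hb : (b * (d * RtoC (momentum_minor g h)))%C = RtoC 0).
{ transitivity ((a * (c * snd (snd g)) + b * (d * snd (snd h))) * RtoC (fst (snd g))
   - (a * (c * fst (snd g)) + b * (d * fst (snd h))) * RtoC (snd (snd g)))%C.
  - unfold momentum_minor; rewrite RtoC_minus, !RtoC_mult; ring.
  - rewrite E1, E2; ring. }
assert (Z : forall x y w : C, x <> RtoC 0 -> y <> RtoC 0 -> (w * (x * y))%C = RtoC 0 -> w = RtoC 0).
{ intros x y w Hx Hy E.
  transitivity (w * (x * y) / (x * y))%C; [ field; auto | rewrite E ].
  field; auto. }
split; eauto.
Qed.

(** At a fixed base point the lift is linear in the momenta, so the minor is multiplied by the
    determinant of p_u with respect to p_q, which is (u1 - u2) / (4 q1) = - r / (2 q1), with r the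
    radius. *)
Lemma momentum_minor_lift (z g h : phase) :
  fst (fst z) <> 0 -> momentum_minor g h <> 0 ->
  momentum_minor (lift_pullback z g) (lift_pullback z h) <> 0.
Proof.
destruct z as [[q1 q2] [p1 p2]], g as [[g1 g2] [g3 g4]], h as [[h1 h2] [h3 h4]].
cbn [fst]; intros Hq Hm E; apply Hm.
pose proof (radius_pos _ q2 Hq) as Hr.
pose proof (sqrt_lt_R0 _ Hr) as Hs.
revert E; unfold momentum_minor, lift_pullback, pairing, lift_velocity;
  cbn [fst snd]; intros E.
apply (Rmult_eq_reg_l (- sqrt (q1 ^ 2 + q2 ^ 2) / (2 * q1))).
2: { apply Rmult_integral_contrapositive; split; [ lra | ].
     apply Rinv_neq_0_compat; lra. }
rewrite Rmult_0_r; etransitivity; [ | exact E ].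
field; lra.
Qed.

(** * Density of the points where the momentum minor is nonzero *)

Lemma avoid_two (a b x eps : R) :
  0 < eps -> exists y, Rabs (y - x) < eps /\ y <> a /\ y <> b.
Proof.
intros He.
assert (B : forall j, 0 <= j < 1 -> Rabs (x + j * eps - x) < eps).
{ intros j Hj; rewrite Rabs_pos_eq; nra. }
(* Two values cannot exclude all three candidates, at offsets 0, [eps / 2] and [eps / 3]. *)
destruct (Req_dec (x + 0 * eps) a), (Req_dec (x + 0 * eps) b),
  (Req_dec (x + / 2 * eps) a), (Req_dec (x + / 2 * eps) b);
  try (exfalso; lra);
  first [ exists (x + 0 * eps); split; [ apply B; lra | split; lra ]
        | exists (x + / 2 * eps); split; [ apply B; lra | split; lra ]
        | exists (x + / 3 * eps); split; [ apply B; lra | split; lra ] ].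
Qed.

(* A function of t with nonzero third difference cannot vanish at four
   equidistant points. *)
Lemma third_difference_nonzero (f : R -> R) (d : R) :
  f (3 * d) - 3 * f (2 * d) + 3 * f d - f 0 <> 0 -> 0 < d ->
  exists t, 0 <= t <= 3 * d /\ f t <> 0.
Proof.
intros Hf Hd.
destruct (Req_dec (f 0) 0) as [E0 | ?]; [| exists 0; split; [ lra | auto ] ].
destruct (Req_dec (f d) 0) as [E1 | ?]; [| exists d; split; [ lra | auto ] ].
destruct (Req_dec (f (2 * d)) 0) as [E2 | ?];
  [| exists (2 * d); split; [ lra | auto ] ].
exists (3 * d); split; [ lra | ].
intros E3; apply Hf; rewrite E0, E1, E2, E3; ring.
Qed.

(** The factors that can vanish in the leading coefficients of [M3] and [M2] as polynomials in
    p_{u1}. *)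
Definition generic (k : R) (u : plane) : Prop :=
  fst u <> 0 /\ snd u <> 0 /\ k * fst u + snd u <> 0.

(** For a cubic the third difference with step [d] is 6 d^3 times the leading coefficient. Steps of
    either sign are included since the lifted lines in [generic_dense_lift] run towards decreasing
    p_{u1}. *)
Definition cubic_in_p1 (k : R) (M : phase -> R) : Prop :=
  forall u1 u2 p1 p2 d, u1 <> u2 -> generic k (u1, u2) -> d <> 0 ->
    M ((u1, u2), (p1 + 3 * d, p2)) - 3 * M ((u1, u2), (p1 + 2 * d, p2))
    + 3 * M ((u1, u2), (p1 + d, p2)) - M ((u1, u2), (p1, p2)) <> 0.

Definition near (z : phase) (eps : R) (z' : phase) : Prop :=
  Rabs (fst (fst z') - fst (fst z)) < eps /\
  Rabs (snd (fst z') - snd (fst z)) < eps /\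
  Rabs (fst (snd z') - fst (snd z)) < eps /\
  Rabs (snd (snd z') - snd (snd z)) < eps.

Lemma locally_near (z : phase) (P : phase -> Prop) :
  locally z P -> exists eps, 0 < eps /\ forall z', near z eps z' -> P z'.
Proof.
intros [eps H]; exists eps; split; [ apply cond_pos | ].
intros z' (H1 & H2 & H3 & H4); apply H; repeat split; assumption.
Qed.

Lemma locally_base (z : phase) (Q : plane -> Prop) :
  locally (fst z) Q -> locally z (fun z' => Q (fst z')).
Proof. intros [eps H]; exists eps; intros z' [B _]; apply H, B. Qed.

Lemma generic_dense (D : plane -> Prop) (k : R) (M : phase -> R) :
  0 < k -> open D -> (forall u, D u -> off_diagonal u) -> cubic_in_p1 k M ->
  forall z, D (fst z) -> forall P : phase -> Prop, locally z P ->
  exists z', D (fst z') /\ P z' /\ generic k (fst z') /\ M z' <> 0.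
Proof.
intros Hk HD Hoff HM [[u1 u2] [p1 p2]] Hz P HP.
pose proof (locally_base ((u1, u2), (p1, p2)) D (HD _ Hz)) as HDz.
destruct (locally_near _ _ (filter_and _ _ HP HDz)) as (eps & He & H).
(* The coordinate u2 is moved first, so that k u1 + u2 = 0 then excludes a single value of u1. *)
destruct (avoid_two 0 0 u2 eps He) as (v2 & B2 & N2 & _).
destruct (avoid_two 0 (- v2 / k) u1 eps He) as (v1 & B1 & N1 & N1').
assert (G : generic k (v1, v2)).
{ repeat split; cbn [fst snd]; auto.
  intros E; apply N1'; apply (Rmult_eq_reg_l k); [| lra ].
  transitivity (- v2); [ lra | field; lra ]. }
assert (NP : forall t, 0 <= t < eps -> P ((v1, v2), (p1 + t, p2)) /\ D (v1, v2)).
{ intros t Ht; apply (H ((v1, v2), (p1 + t, p2))).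
  unfold near; cbn [fst snd]; repeat split; auto.
  - rewrite Rabs_pos_eq; lra.
  - rewrite Rminus_diag, Rabs_R0; lra. }
assert (HDv : D (v1, v2)) by (apply (NP 0); lra).
(* Three steps of [eps / 6] stay within [eps / 2] of [p1]. *)
destruct (third_difference_nonzero (fun t => M ((v1, v2), (p1 + t, p2))) (eps / 6))
  as (t & Ht & Mt).
- rewrite Rplus_0_r; apply HM; [ exact (Hoff _ HDv) | exact G | lra ].
- lra.
- exists ((v1, v2), (p1 + t, p2)); cbn [fst]; split; [| split; [| split]]; auto.
  apply NP; lra.
Qed.

Lemma lift_base_locally (q1 q2 : R) (D : plane -> Prop) :
  q1 <> 0 -> open D -> D (u1_of (q1, q2), u2_of (q1, q2)) ->
  locally q2 (fun y => D (u1_of (q1, y), u2_of (q1, y))).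
Proof.
intros Hq HD Hz.
destruct (parabolic_lift_conjugate q1 q2 0 0 Hq)
  as (a11 & a12 & a21 & a22 & _ & H1 & _ & H2 & _).
(* Zero momenta complete the base curve to a curve in phase space, as [locally_curve] requires. *)
assert (Hv : is_velocity (fun y => u1_of (q1, y)) (fun y => u2_of (q1, y))
  (fun _ => 0) (fun _ => 0) q2 ((a12, a22), (0, 0))).
{ split; [| split; [| split]]; auto; cbn [fst snd]; auto_derive; auto. }
apply (locally_curve _ _ _ _ _ _ _ (fun z => D (fst z)) Hv eq_refl).
apply locally_base; exact (HD _ Hz).
Qed.

Lemma lift_off_diagonal (q1 q2 : R) :
  q1 <> 0 -> u1_of (q1, q2) <> u2_of (q1, q2).
Proof.
intros Hq; pose proof (sqrt_lt_R0 _ (radius_pos q1 q2 Hq)).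
unfold u1_of, u2_of; cbn [fst snd]; lra.
Qed.

Lemma lift_product (q1 q2 : R) : u1_of (q1, q2) * u2_of (q1, q2) = - q1 ^ 2.
Proof.
assert (H : 0 <= q1 ^ 2 + q2 ^ 2)
  by (pose proof (pow2_ge_0 q1); pose proof (pow2_ge_0 q2); lra).
pose proof (pow2_sqrt _ H) as E.
unfold u1_of, u2_of; cbn [fst snd]; nra.
Qed.

(* Eliminating the radius from k u1 + u2 = 0. *)
Lemma lift_degenerate (k q1 q2 : R) :
  k * u1_of (q1, q2) + u2_of (q1, q2) = 0 ->
  4 * k * q2 ^ 2 = (k - 1) ^ 2 * q1 ^ 2.
Proof.
assert (H : 0 <= q1 ^ 2 + q2 ^ 2)
  by (pose proof (pow2_ge_0 q1); pose proof (pow2_ge_0 q2); lra).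
pose proof (pow2_sqrt _ H) as E.
unfold u1_of, u2_of; cbn [fst snd]; intros E'.
assert (E2 : (k + 1) * q2 = (k - 1) * sqrt (q1 ^ 2 + q2 ^ 2)) by lra.
assert (E3 : (k + 1) ^ 2 * q2 ^ 2 = (k - 1) ^ 2 * (q1 ^ 2 + q2 ^ 2)).
{ rewrite <- E, <- !Rpow_mult_distr, E2; reflexivity. }
lra.
Qed.

(** With q1 fixed, u1 u2 = - q1^2 keeps both coordinates nonzero, and moving q2 leaves the locus k
    u1 + u2 = 0. The momenta then move along a line whose lift changes p_{u1} alone. *)
Lemma generic_dense_lift (D : plane -> Prop) (k : R) (M : phase -> R) :
  0 < k -> open D -> cubic_in_p1 k M ->
  forall z, cartesian_domain D z -> forall P : phase -> Prop, locally z P ->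
  exists z', cartesian_domain D z' /\ P z' /\
    generic k (fst (parabolic_lift z')) /\ M (parabolic_lift z') <> 0.
Proof.
intros Hk HD HM [[q1 q2] [p1 p2]] [Hq Hz] P HP; cbn [fst parabolic_lift] in Hq, Hz.
destruct (lift_base_locally q1 q2 D Hq HD Hz) as [e1 He1].
destruct (locally_near _ _ HP) as (e2 & He2 & H).
set (e := Rmin e1 e2).
assert (He : 0 < e) by (apply Rmin_pos; [ apply cond_pos | exact He2 ]).
(* By [lift_degenerate], degeneracy forces q2 to be [a] or [- a]. *)
set (a := sqrt ((k - 1) ^ 2 * q1 ^ 2 / (4 * k))).
destruct (avoid_two a (- a) q2 e He) as (y & By & Na & Na').
assert (HDy : D (u1_of (q1, y), u2_of (q1, y))).
{ apply He1; change (Rabs (y - q2) < e1).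
  eapply Rlt_le_trans; [ exact By | apply Rmin_l ]. }
pose proof (lift_product q1 y) as Hp.
pose proof (pow2_gt_0 q1 Hq) as Hq2.
assert (G : generic k (u1_of (q1, y), u2_of (q1, y))).
{ repeat split; cbn [fst snd].
  - intros E; rewrite E in Hp; lra.
  - intros E; rewrite E in Hp; lra.
  - intros E; apply lift_degenerate in E.
    assert (Ha : 0 <= (k - 1) ^ 2 * q1 ^ 2 / (4 * k)).
    { apply Rle_mult_inv_pos; [| lra ].
      apply Rmult_le_pos; apply pow2_ge_0. }
    assert (Ea : a ^ 2 = y ^ 2).
    { unfold a; rewrite pow2_sqrt by exact Ha; rewrite <- E; field; lra. }
    assert (Z : (y - a) * (y + a) = 0) by lra.
    apply Rmult_integral in Z; destruct Z; lra. }
pose proof (lift_off_diagonal q1 y Hq) as Hoff.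
set (u1 := u1_of (q1, y)) in *; set (u2 := u2_of (q1, y)) in *.
(* Along this line p_{u2} is constant and p_{u1} has nonzero slope. *)
set (w := fun t => ((q1, y), (p1 + t * q1, p2 + t * u1)) : phase).
assert (Hw : forall t, parabolic_lift (w t) =
  ((u1, u2), ((p2 - u2 / q1 * p1) / 2 + t * ((u1 - u2) / 2),
              (p2 - u1 / q1 * p1) / 2))).
{ intros t; unfold w, parabolic_lift; fold u1 u2; cbn [fst].
  f_equal; f_equal; field; exact Hq. }
(* [B] bounds the speed of both momenta along [w], so three steps of [d] move each by at most
   [e / 2]. *)
set (B := Rabs q1 + Rabs u1).
assert (HB : 0 < B) by (pose proof (Rabs_pos_lt q1 Hq); pose proof (Rabs_pos u1); unfold B; lra).
set (d := e / (6 * B)).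
assert (Hd : 0 < d) by (apply Rdiv_lt_0_compat; lra).
assert (HdB : 3 * d * B < e).
{ unfold d; replace (3 * (e / (6 * B)) * B) with (e / 2) by (field; lra); lra. }
destruct (third_difference_nonzero (fun t => M (parabolic_lift (w t))) d) as (t & Ht & Mt).
- rewrite !Hw.
  (* The third difference in t is one in p_{u1} with the negative step [d * ((u1 - u2) / 2)]. *)
  replace (0 * ((u1 - u2) / 2)) with 0 by ring; rewrite Rplus_0_r, !Rmult_assoc.
  apply HM; auto.
  apply Rmult_integral_contrapositive; split; lra.
- exact Hd.
- exists (w t).
  assert (Ee : e <= e2) by apply Rmin_r.
  assert (Hs : forall x, Rabs x <= B -> Rabs (t * x) < e2).
  { intros x Hx; rewrite Rabs_mult, (Rabs_pos_eq t) by lra.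
    pose proof (Rabs_pos x); nra. }
  unfold cartesian_domain; rewrite Hw; cbn [fst].
  split; [ split; [ exact Hq | exact HDy ] | split; [| split; [ exact G |]]].
  + apply H; unfold near, w; cbn [fst snd]; repeat split.
    * rewrite Rminus_diag, Rabs_R0; lra.
    * lra.
    * replace (p1 + t * q1 - p1) with (t * q1) by ring.
      apply Hs; unfold B; pose proof (Rabs_pos u1); lra.
    * replace (p2 + t * u1 - p2) with (t * u1) by ring.
      apply Hs; unfold B; pose proof (Rabs_pos q1); lra.
  + rewrite Hw in Mt; exact Mt.
Qed.

(** * From pointwise differentials to integrability *)

(** The same data serve both coordinate systems: in Cartesian coordinates they are taken at the
    lifted point and pulled back, which preserves the bracket and the nonvanishing of the minor. *)
Lemma integrable_parabolic_criterion
    (D : plane -> Prop) (k : R) (M : phase -> R) (T K : phase -> C) :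
  0 < k -> open D -> (forall u, D u -> off_diagonal u) -> cubic_in_p1 k M ->
  (forall z, D (fst z) -> exists c d g h,
     has_Cdifferential T z c g /\ has_Cdifferential K z d h /\
     real_poisson g h = 0 /\
     (generic k (fst z) -> M z <> 0 ->
      c <> RtoC 0 /\ d <> RtoC 0 /\ momentum_minor g h <> 0)) ->
  integrable_parabolic D T K.
Proof.
intros Hk HD Hoff HM H; split; split.
- intros z Hz; destruct (H z Hz) as (c & d & g & h & HT & HK & E & _).
  exists (Cgradient c g), (Cgradient d h); split; [| split].
  + apply has_Cdifferential_gradient, HT.
  + apply has_Cdifferential_gradient, HK.
  + apply poisson_Cgradient, E.
- intros z Hz P HP.
  destruct (generic_dense D k M Hk HD Hoff HM z Hz P HP)
    as (z' & Hz' & HP' & G & HMz).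
  exists z'; split; [ exact Hz' | split; [ exact HP' | ] ].
  destruct (H z' Hz') as (c & d & g & h & HT & HK & _ & N).
  destruct (N G HMz) as (Nc & Nd & Nm).
  exists (Cgradient c g), (Cgradient d h); split; [| split].
  + apply has_Cdifferential_gradient, HT.
  + apply has_Cdifferential_gradient, HK.
  + apply lin_indep_Cgradient; assumption.
- intros z [Hq Hz]; destruct (H _ Hz) as (c & d & g & h & HT & HK & E & _).
  exists (Cgradient c (lift_pullback z g)), (Cgradient d (lift_pullback z h)).
  split; [| split].
  + apply has_Cdifferential_gradient, has_Cdifferential_lift; assumption.
  + apply has_Cdifferential_gradient, has_Cdifferential_lift; assumption.
  + apply poisson_Cgradient; rewrite real_poisson_lift; assumption.
- intros z Hz P HP.
  destruct (generic_dense_lift D k M Hk HD HM z Hz P HP)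
    as (z' & [Hq Hz'] & HP' & G & HMz).
  exists z'; split; [ split; assumption | split; [ exact HP' | ] ].
  destruct (H _ Hz') as (c & d & g & h & HT & HK & _ & N).
  destruct (N G HMz) as (Nc & Nd & Nm).
  exists (Cgradient c (lift_pullback z' g)), (Cgradient d (lift_pullback z' h)).
  split; [| split].
  + apply has_Cdifferential_gradient, has_Cdifferential_lift; assumption.
  + apply has_Cdifferential_gradient, has_Cdifferential_lift; assumption.
  + apply lin_indep_Cgradient; auto.
    apply momentum_minor_lift; assumption.
Qed.

Lemma homogeneous_common_factor (D : plane -> Prop) (F : phase -> C) :
  has_momentum_factor D 2 common_factor F -> homogeneous_in_momenta D 3 F.
Proof.
intros (Q & [c Hc] & HF).
(* Coefficients of the product of the linear factor with a binary quadratic form, [i] being the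
   power of p1. *)
exists (fun i u =>
  match i with
  | 0%nat => - (RtoC (snd u ^ 2) * c 0%nat u)
  | 1%nat => RtoC (fst u ^ 2) * c 0%nat u - RtoC (snd u ^ 2) * c 1%nat u
  | 2%nat => RtoC (fst u ^ 2) * c 1%nat u - RtoC (snd u ^ 2) * c 2%nat u
  | _ => RtoC (fst u ^ 2) * c 2%nat u
  end)%C.
intros [u1 u2] p1 p2 Hu; rewrite HF, Hc by exact Hu.
rewrite !sum_Sn, !sum_O; unfold common_factor; cbn [fst snd].
generalize (c 0%nat (u1, u2)) (c 1%nat (u1, u2)) (c 2%nat (u1, u2)).
intros c0 c1 c2; change (@plus C_AbelianMonoid) with Cplus.
cbn [Nat.sub pow].
rewrite !RtoC_minus, !RtoC_mult; ring.
Qed.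

Lemma open_off_diagonal : open off_diagonal.
Proof.
intros [x y] Hxy; cbn in Hxy.
assert (He : 0 < Rabs (x - y) / 2) by (pose proof (Rabs_pos_lt (x - y) (Rminus_eq_contra _ _ Hxy)); lra).
exists (mkposreal _ He); intros [x' y'] [B1 B2] E.
change (Rabs (x' - x) < Rabs (x - y) / 2) in B1.
change (Rabs (y' - y) < Rabs (x - y) / 2) in B2.
cbn in E; subst y'; revert B1 B2; unfold Rabs; repeat destruct Rcase_abs; lra.
Qed.

(** * Explicit differentials of T and K and their brackets *)

Definition T_real (k : R) (m : nat) (z : phase) : R :=
  (k * fst (fst z) + snd (fst z)) * fst (fst z) ^ m
    / (fst (fst z) - snd (fst z)) * fst (snd z) ^ 2 +
  (k * snd (fst z) + fst (fst z)) * snd (fst z) ^ m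
    / (snd (fst z) - fst (fst z)) * snd (snd z) ^ 2.

(** Both terms of T are put over [u1 - u2], whence the signs of the p2 terms. *)
Definition dT (k : R) (m : nat) (z : phase) : phase :=
  let '((u1, u2), (p1, p2)) := z in
  let n := INR m in
  (((k * u1 ^ m + (k * u1 + u2) * (n * u1 ^ pred m)) / (u1 - u2) * p1 ^ 2
      - ((k * u1 + u2) * u1 ^ m * p1 ^ 2 - (k * u2 + u1) * u2 ^ m * p2 ^ 2)
        / (u1 - u2) ^ 2 - u2 ^ m / (u1 - u2) * p2 ^ 2,
    - (k * u2 ^ m + (k * u2 + u1) * (n * u2 ^ pred m)) / (u1 - u2) * p2 ^ 2
      + ((k * u1 + u2) * u1 ^ m * p1 ^ 2 - (k * u2 + u1) * u2 ^ m * p2 ^ 2)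
        / (u1 - u2) ^ 2 + u1 ^ m / (u1 - u2) * p1 ^ 2),
   (2 * ((k * u1 + u2) * u1 ^ m / (u1 - u2)) * p1,
    - 2 * ((k * u2 + u1) * u2 ^ m / (u1 - u2)) * p2)).

Definition K3_real (m : nat) (rho : plane -> R) (z : phase) : R :=
  (fst (fst z) ^ 2 * fst (snd z) - snd (fst z) ^ 2 * snd (snd z)) *
  (rho (fst z) *
   ((fst (fst z) ^ m * fst (snd z) ^ 2 - snd (fst z) ^ m * snd (snd z) ^ 2)
     / (fst (fst z) - snd (fst z)) ^ 2)).

(* (r, r1, r2) is the 1-jet of rho at (u1, u2). *)
Definition dK3 (m : nat) (r r1 r2 : R) (z : phase) : phase :=
  let '((u1, u2), (p1, p2)) := z in
  let n := INR m in
  let L := u1 ^ 2 * p1 - u2 ^ 2 * p2 in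
  let N := u1 ^ m * p1 ^ 2 - u2 ^ m * p2 ^ 2 in
  let d := u1 - u2 in
  ((2 * u1 * p1 * r * N / d ^ 2 + L * r1 * N / d ^ 2
      + L * r * (n * u1 ^ pred m * p1 ^ 2) / d ^ 2 - 2 * L * r * N / d ^ 3,
    - 2 * u2 * p2 * r * N / d ^ 2 + L * r2 * N / d ^ 2
      - L * r * (n * u2 ^ pred m * p2 ^ 2) / d ^ 2 + 2 * L * r * N / d ^ 3),
   (r * (u1 ^ 2 * N + L * (2 * u1 ^ m * p1)) / d ^ 2,
    - r * (u2 ^ 2 * N + L * (2 * u2 ^ m * p2)) / d ^ 2)).

Definition K2_real (m : nat) (z : phase) : R :=
  (fst (fst z) ^ 2 * fst (snd z) - snd (fst z) ^ 2 * snd (snd z)) *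
  (fst (fst z) ^ m * snd (fst z) ^ m * (fst (snd z) - snd (snd z)) ^ 2
    / (fst (fst z) - snd (fst z)) ^ 3).

Definition dK2 (z : phase) : phase :=
  let '((u1, u2), (p1, p2)) := z in
  let L := u1 ^ 2 * p1 - u2 ^ 2 * p2 in
  let q := p1 - p2 in
  let d := u1 - u2 in
  ((2 * u1 * p1 * u1 * u2 * q ^ 2 / d ^ 3 + L * u2 * q ^ 2 / d ^ 3
      - 3 * L * u1 * u2 * q ^ 2 / d ^ 4,
    - 2 * u2 * p2 * u1 * u2 * q ^ 2 / d ^ 3 + L * u1 * q ^ 2 / d ^ 3
      + 3 * L * u1 * u2 * q ^ 2 / d ^ 4),
   (u1 * u2 * (u1 ^ 2 * q ^ 2 + 2 * L * q) / d ^ 3,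
    - u1 * u2 * (u2 ^ 2 * q ^ 2 + 2 * L * q) / d ^ 3)).

Lemma T_differential (k : R) (m : nat) (z : phase) :
  off_diagonal (fst z) -> has_differential (T_real k m) z (dT k m z).
Proof.
intros Hz x1 x2 y1 y2 t v Hv <-.
unfold off_diagonal in Hz; cbn [fst snd] in Hz.
destruct (is_velocity_Derive _ _ _ _ _ _ Hv)
  as [(X1 & X2 & X3 & X4) (E1 & E2 & E3 & E4)].
unfold T_real, dT, pairing; cbn [fst snd].
auto_derive; [ repeat split; solve [ assumption | lra ] | ].
change (fun x => x1 x) with x1; change (fun x => x2 x) with x2;
change (fun x => y1 x) with y1; change (fun x => y2 x) with y2.
rewrite E1, E2, E3, E4; cbn [pred INR].
match goal with |- ?a = ?b => change (@eq R a b) end.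
field; lra.
Qed.

Lemma K3_differential (m : nat) (rho : plane -> R) (z : phase) (r1 r2 : R) :
  off_diagonal (fst z) ->
  has_differential (fun z' => rho (fst z')) z ((r1, r2), (0, 0)) ->
  has_differential (K3_real m rho) z (dK3 m (rho (fst z)) r1 r2 z).
Proof.
intros Hz Hrho x1 x2 y1 y2 t v Hv E.
specialize (Hrho _ _ _ _ _ _ Hv E); subst z; cbn [fst] in Hrho.
unfold off_diagonal in Hz; cbn [fst snd] in Hz.
(* The weight along the curve becomes an opaque function of one variable with known derivative,
   which [auto_derive] treats as an atom. *)
set (f := fun s : R => rho (x1 s, x2 s)).
change (is_derive f t (pairing ((r1, r2), (0, 0)) v)) in Hrho.
pose proof (is_derive_unique _ _ _ Hrho) as E0.
assert (X0 : ex_derive f t) by (eexists; exact Hrho).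
destruct (is_velocity_Derive _ _ _ _ _ _ Hv)
  as [(X1 & X2 & X3 & X4) (E1 & E2 & E3 & E4)].
unfold K3_real, dK3; cbn [fst snd].
apply (is_derive_ext (fun s =>
  (x1 s ^ 2 * y1 s - x2 s ^ 2 * y2 s) *
   (f s * ((x1 s ^ m * y1 s ^ 2 - x2 s ^ m * y2 s ^ 2) / (x1 s - x2 s) ^ 2))));
  [ reflexivity | ].
change (rho (x1 t, x2 t)) with (f t).
clearbody f.
auto_derive.
{ assert (x1 t - x2 t <> 0) by lra.
  repeat split; auto; repeat apply Rmult_integral_contrapositive_currified; auto; lra. }
change (fun x => f x) with f;
change (fun x => x1 x) with x1; change (fun x => x2 x) with x2;
change (fun x => y1 x) with y1; change (fun x => y2 x) with y2.
rewrite E0, E1, E2, E3, E4; unfold pairing; cbn [fst snd pred INR].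
match goal with |- ?a = ?b => change (@eq R a b) end.
field; lra.
Qed.

Lemma K2_differential (z : phase) :
  off_diagonal (fst z) -> has_differential (K2_real 1) z (dK2 z).
Proof.
intros Hz x1 x2 y1 y2 t v Hv <-.
unfold off_diagonal in Hz; cbn [fst snd] in Hz.
destruct (is_velocity_Derive _ _ _ _ _ _ Hv)
  as [(X1 & X2 & X3 & X4) (E1 & E2 & E3 & E4)].
unfold K2_real, dK2, pairing; cbn [fst snd].
auto_derive.
{ assert (x1 t - x2 t <> 0) by lra.
  repeat split; auto; repeat apply Rmult_integral_contrapositive_currified; auto; lra. }
change (fun x => x1 x) with x1; change (fun x => x2 x) with x2;
change (fun x => y1 x) with y1; change (fun x => y2 x) with y2.
rewrite E1, E2, E3, E4; cbn [pred INR].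
match goal with |- ?a = ?b => change (@eq R a b) end.
field; lra.
Qed.

(* The relations on r1, r2 say that r varies like (u1 u2)^(m/2). *)
Lemma poisson_T_K3 (m : nat) (z : phase) (r r1 r2 : R) :
  m = 3%nat \/ m = 4%nat -> off_diagonal (fst z) ->
  2 * (fst (fst z) * r1) = INR m * r -> 2 * (snd (fst z) * r2) = INR m * r ->
  real_poisson (dT 3 m z) (dK3 m r r1 r2 z) = 0.
Proof.
destruct z as [[u1 u2] [p1 p2]]; unfold off_diagonal; cbn [fst snd].
intros Hm Hz R1 R2.
(* With r = 2 s the relations read u_i r_i = m s, free of the factor 2, and serve [field] as
   rewriting rules. *)
replace r with (2 * (r / 2)) in * by field; set (s := r / 2) in *; clearbody s.
assert (R1' : u1 * r1 = INR m * s) by lra.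
assert (R2' : u2 * r2 = INR m * s) by lra.
clear R1 R2.
destruct Hm as [-> | ->]; unfold real_poisson, dT, dK3; cbn [fst snd];
  simpl INR in *; cbn [pred];
  field [R1' R2']; lra.
Qed.

Lemma poisson_T_K2 (z : phase) :
  off_diagonal (fst z) -> real_poisson (dT 2 1 z) (dK2 z) = 0.
Proof.
destruct z as [[u1 u2] [p1 p2]]; unfold off_diagonal; cbn [fst snd]; intros Hz.
unfold real_poisson, dT, dK2; cbn [fst snd]; simpl INR; cbn [pred]; field; lra.
Qed.

(** * The momentum minors as cubics in p_{u1} *)

Lemma RtoC_neq (x y : R) : x <> y -> RtoC x <> RtoC y.
Proof. intros H E; apply H, RtoC_inj, E. Qed.

Definition M3 (m : nat) (z : phase) : R :=
  momentum_minor (dT 3 m z) (dK3 m 1 0 0 z).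

(** The weight depends on the base point alone, so its derivatives do not enter the momentum
    components and its value factors out. *)
Lemma momentum_minor_K3 (m : nat) (r r1 r2 : R) (z : phase) :
  momentum_minor (dT 3 m z) (dK3 m r r1 r2 z) = r * M3 m z.
Proof.
destruct z as [[u1 u2] [p1 p2]].
unfold M3, momentum_minor, dT, dK3, Rdiv; cbn [fst snd]; ring.
Qed.

Lemma M3_cubic (m : nat) : cubic_in_p1 3 (M3 m).
Proof.
intros u1 u2 p1 p2 d Hu (N1 & N2 & N3) Hd; cbn [fst snd] in N1, N2, N3.
(* This is 6 d^3 times the coefficient of p1^3, which is -2 (3 u1 + u2) u1^(2m) u2^2 / (u1 -
   u2)^3. *)
replace (_ - _) with
  (-12 * d ^ 3 * (3 * u1 + u2) * (u1 ^ m) ^ 2 * u2 ^ 2 / (u1 - u2) ^ 3).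
2: { unfold M3, momentum_minor, dT, dK3; cbn [fst snd]; field; lra. }
repeat (apply Rmult_integral_contrapositive_currified || apply Rinv_neq_0_compat
  || apply pow_nonzero); lra.
Qed.

Definition M2 (z : phase) : R := momentum_minor (dT 2 1 z) (dK2 z).

Lemma M2_cubic : cubic_in_p1 2 M2.
Proof.
intros u1 u2 p1 p2 d Hu (N1 & N2 & N3) Hd; cbn [fst snd] in N1, N2, N3.
replace (_ - _) with
  (-12 * d ^ 3 * (2 * u1 + u2) * u1 ^ 2 * u2 * (2 * u1 ^ 2 + u2 ^ 2)
     / (u1 - u2) ^ 4).
2: { unfold M2, momentum_minor, dT, dK2; cbn [fst snd]; field; lra. }
(* The extra factor 2 u1^2 + u2^2 is positive because u1 is nonzero. *)
pose proof (pow2_gt_0 u1 N1); pose proof (pow2_ge_0 u2).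
repeat (apply Rmult_integral_contrapositive_currified || apply Rinv_neq_0_compat
  || apply pow_nonzero); lra.
Qed.

(** * The complex observables and their common linear factor *)

Lemma T_Cdifferential (k : R) (m : nat) (z : phase) :
  off_diagonal (fst z) ->
  has_Cdifferential (geodesic_hamiltonian (metric k m)) z 1 (dT k m z).
Proof.
intros Hz; apply (has_Cdifferential_loc _ (T_real k m)).
- apply filter_forall; intros [[u1 u2] [p1 p2]].
  unfold geodesic_hamiltonian, metric, T_real, coeff_mat; simpl coeff_Tn.
  cbn [fst snd]; rewrite Cmult_1_l; f_equal; ring.
- apply T_differential, Hz.
Qed.

Lemma K3_Cdifferential (m : nat) (w : plane -> C) (c : C) (rho : plane -> R)
    (z : phase) (r1 r2 : R) :
  off_diagonal (fst z) ->
  locally (fst z) (fun u => w u = (c * RtoC (rho u))%C) ->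
  has_differential (fun z' => rho (fst z')) z ((r1, r2), (0, 0)) ->
  has_Cdifferential (K3 m w) z c (dK3 m (rho (fst z)) r1 r2 z).
Proof.
intros Hz Hw Hr; apply (has_Cdifferential_loc _ (K3_real m rho)).
- assert (Hloc : forall z' : phase, w (fst z') = (c * RtoC (rho (fst z')))%C ->
    K3 m w z' = (c * RtoC (K3_real m rho z'))%C).
  2: { generalize (locally_base _ _ Hw); apply filter_imp; exact Hloc. }
  intros [[u1 u2] [p1 p2]]; cbn [fst]; intros E.
  unfold K3, K3_real, common_factor; cbn [fst snd].
  rewrite E, !(RtoC_mult (_ - _)), (RtoC_mult (rho _)); ring.
- apply K3_differential; assumption.
Qed.

Lemma K2_Cdifferential (z : phase) :
  off_diagonal (fst z) -> has_Cdifferential (K2 1) z 1 (dK2 z).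
Proof.
intros Hz; apply (has_Cdifferential_loc _ (K2_real 1)).
- apply filter_forall; intros [[u1 u2] [p1 p2]].
  unfold K2, K2_real, common_factor; cbn [fst snd].
  rewrite !(RtoC_mult (_ - _)); ring.
- apply K2_differential, Hz.
Qed.

Lemma K3_factor (D : plane -> Prop) (m : nat) (w : plane -> C) :
  has_momentum_factor D 2 common_factor (K3 m w).
Proof.
exists (fun z => w (fst z) * RtoC
  ((fst (fst z) ^ m * fst (snd z) ^ 2 - snd (fst z) ^ m * snd (snd z) ^ 2)
    / (fst (fst z) - snd (fst z)) ^ 2))%C.
split; [| intros [[u1 u2] [p1 p2]] _; reflexivity ].
exists (fun i u => w u * RtoC (match i with
  | 0%nat => - snd u ^ m / (fst u - snd u) ^ 2
  | 1%nat => 0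
  | _ => fst u ^ m / (fst u - snd u) ^ 2
  end))%C.
intros [u1 u2] p1 p2 _; cbn [fst snd].
rewrite !sum_Sn, !sum_O; change (@plus C_AbelianMonoid) with Cplus.
rewrite <- !Cmult_assoc, <- !Cmult_plus_distr_l, <- !RtoC_mult, <- !RtoC_plus.
do 2 f_equal; unfold Rdiv; cbn [Nat.sub]; ring.
Qed.

Lemma K2_factor (D : plane -> Prop) (m : nat) :
  has_momentum_factor D 2 common_factor (K2 m).
Proof.
exists (fun z => RtoC
  (fst (fst z) ^ m * snd (fst z) ^ m * (fst (snd z) - snd (snd z)) ^ 2
    / (fst (fst z) - snd (fst z)) ^ 3)).
split; [| intros [[u1 u2] [p1 p2]] _; reflexivity ].
exists (fun i u => RtoC (match i with 1%nat => -2 | _ => 1 end *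
  (fst u ^ m * snd u ^ m / (fst u - snd u) ^ 3))).
intros [u1 u2] p1 p2 _; cbn [fst snd].
rewrite !sum_Sn, !sum_O; change (@plus C_AbelianMonoid) with Cplus.
rewrite <- !RtoC_mult, <- !RtoC_plus.
f_equal; unfold Rdiv; cbn [Nat.sub]; ring.
Qed.

(** Common treatment of m = 3 and m = 4: the weight enters through a local form c rho with rho real
    and u_i d rho / d u_i = (m / 2) rho. *)
Lemma K3_integrable (D : plane -> Prop) (m : nat) (w : plane -> C) :
  m = 3%nat \/ m = 4%nat ->
  open D -> (forall u, D u -> off_diagonal u) ->
  (forall u, D u -> exists (c : C) (rho : plane -> R) (r1 r2 : R),
     locally u (fun u' => w u' = (c * RtoC (rho u'))%C) /\
     (forall p, has_differential (fun z => rho (fst z)) (u, p)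
                  ((r1, r2), (0, 0))) /\
     2 * (fst u * r1) = INR m * rho u /\ 2 * (snd u * r2) = INR m * rho u /\
     c <> RtoC 0 /\ (fst u <> 0 -> snd u <> 0 -> rho u <> 0)) ->
  integrable_by_cubic D (geodesic_hamiltonian (metric 3 m)) (K3 m w).
Proof.
intros Hm HD Hoff Hw.
split; [| split; [ apply homogeneous_common_factor |]; apply K3_factor ].
apply (integrable_parabolic_criterion D 3 (M3 m)); auto using M3_cubic; [ lra |].
intros [u p] Hu; cbn [fst] in Hu |- *.
destruct (Hw u Hu) as (c & rho & r1 & r2 & Hl & Hd & E1 & E2 & Hc & Hr).
exists (RtoC 1), c, (dT 3 m (u, p)), (dK3 m (rho u) r1 r2 (u, p)).
split; [| split; [| split]].
- apply T_Cdifferential, Hoff, Hu.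
- apply K3_Cdifferential; auto.
- apply poisson_T_K3; auto.
- intros (N1 & N2 & _) HM; split; [| split]; auto.
  + apply RtoC_neq; lra.
  + rewrite momentum_minor_K3; apply Rmult_integral_contrapositive; auto.
Qed.

(** * Local branches of u1^(3/2) u2^(3/2) *)

Lemma locally_nonzero (f : plane -> R) (u : plane) :
  continuous f u -> f u <> 0 -> locally u (fun v => f v <> 0).
Proof. intros Hf Hu; exact (Hf _ (open_neq 0 _ Hu)). Qed.

(* Near a point, a branch differs from sqrt |u1^3 u2^3| by a constant factor, one
   of 1, -1, i, -i. *)
Lemma branch_local_form (D : plane -> Prop) (s : plane -> C) (u : plane) :
  is_branch_3_2 D s -> D u ->
  exists (c : C) (e : R),
    c <> RtoC 0 /\ 0 < e * (fst u ^ 3 * snd u ^ 3) /\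
    locally u (fun v => s v = (c * RtoC (sqrt (e * (fst v ^ 3 * snd v ^ 3))))%C).
Proof.
intros [HD Hs] Hu; destruct (Hs u Hu) as (N1 & N2 & Hcont & Hsq).
set (g := fun v : plane => fst v ^ 3 * snd v ^ 3).
assert (Ng : g u <> 0)
  by (apply Rmult_integral_contrapositive; split; apply pow_nonzero; assumption).
(* [e] is the sign of u1^3 u2^3 at [u]. *)
assert (He : exists e, e * e = 1 /\ 0 < e * g u).
{ destruct (Rtotal_order (g u) 0) as [H | [H | H]]; [ exists (-1) | | exists 1 ];
    try split; lra. }
destruct He as (e & Hee & Hpos).
set (rho := fun v => sqrt (e * g v)).
assert (Hrho : 0 < rho u) by (apply sqrt_lt_R0, Hpos).
assert (Nrho : RtoC (rho u) <> RtoC 0) by (apply RtoC_neq; lra).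
assert (Ns : s u <> RtoC 0).
{ intros E; rewrite E, Cmult_0_l in Hsq; apply Ng; symmetry; apply RtoC_inj, Hsq. }
set (c := (s u / RtoC (rho u))%C).
assert (Ec : (c * RtoC (rho u))%C = s u) by (unfold c; field; exact Nrho).
assert (Nc : c <> RtoC 0) by (intros E; apply Ns; rewrite <- Ec, E; ring).
assert (Cg : continuous g u).
{ assert (Hp : forall f : plane -> R, continuous f u ->
    continuous (fun v => f v ^ 3) u).
  { intros f Hf; apply (continuous_comp f (fun x => x ^ 3)); [ exact Hf |].
    apply (ex_derive_continuous (V := R_NormedModule)); auto_derive; exact I. }
  apply (continuous_mult (K := R_AbsRing)); apply Hp;
    [ apply continuous_fst | apply continuous_snd ]. }
assert (Ceg : continuous (fun v => e * g v) u)
  by (apply (continuous_mult (K := R_AbsRing)); [ apply continuous_const | exact Cg ]).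
assert (Crho : continuous rho u)
  by (apply (continuous_comp (fun v => e * g v) sqrt);
      [ exact Ceg | apply continuous_sqrt ]).
assert (Hg : locally u (fun v => 0 < e * g v))
  by (apply Ceg, (open_gt 0), Hpos).
(* At [u] this sum is 2 s(u), which is nonzero; by continuity it stays nonzero nearby, which rules
   out the opposite root. *)
assert (Hsum : locally u (fun v => (s v + c * RtoC (rho v))%C <> RtoC 0)).
{ assert (Cf : continuous (fun v => fst (s v) + fst c * rho v) u).
  { apply (continuous_plus (V := R_NormedModule)).
    - apply (continuous_comp s fst); [ exact Hcont | apply continuous_fst ].
    - apply (continuous_mult (K := R_AbsRing));
        [ apply continuous_const | exact Crho ]. }
  assert (Cs : continuous (fun v => snd (s v) + snd c * rho v) u).
  { apply (continuous_plus (V := R_NormedModule)).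
    - apply (continuous_comp s snd); [ exact Hcont | apply continuous_snd ].
    - apply (continuous_mult (K := R_AbsRing));
        [ apply continuous_const | exact Crho ]. }
  assert (Ef : fst c * rho u = fst (s u)) by (rewrite <- Ec; simpl; ring).
  assert (Es : snd c * rho u = snd (s u)) by (rewrite <- Ec; simpl; ring).
  (* Nonvanishing is propagated through whichever of the real and imaginary parts is nonzero at
     [u]. *)
  destruct (Req_dec (fst (s u)) 0) as [Z1 | Z1].
  - assert (Z2 : snd (s u) <> 0)
      by (intros Z2; apply Ns, injective_projections; assumption).
    assert (Q : snd (s u) + snd c * rho u <> 0) by lra.
    generalize (locally_nonzero _ _ Cs Q); apply filter_imp.
    intros v Hv E; apply Hv; apply (f_equal snd) in E; cbn [Cplus Cmult RtoC fst snd] in E; lra.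
  - assert (Q : fst (s u) + fst c * rho u <> 0) by lra.
    generalize (locally_nonzero _ _ Cf Q); apply filter_imp.
    intros v Hv E; apply Hv; apply (f_equal fst) in E; cbn [Cplus Cmult RtoC fst snd] in E; lra. }
exists c, e; split; [ exact Nc | split; [ exact Hpos | ] ].
generalize (filter_and _ _ Hg (filter_and _ _ Hsum (HD u Hu))); apply filter_imp.
intros v (Gv & Sv & Dv); change (s v = (c * RtoC (rho v))%C).
destruct (Hs v Dv) as (_ & _ & _ & Hsv).
(* c^2 = g(u) / (e g(u)) = 1 / e = e. *)
assert (Ecc : (c * c)%C = RtoC e).
{ transitivity (RtoC (g u) / (RtoC (rho u) * RtoC (rho u)))%C.
  - unfold g; rewrite <- Hsq; unfold c; field; exact Nrho.
  - rewrite <- RtoC_mult; unfold rho at 1 2; rewrite sqrt_sqrt by lra.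
    rewrite <- RtoC_div by lra; f_equal.
    apply (Rmult_eq_reg_r (e * g u)); [| lra ].
    transitivity (g u); [ field; split; [ exact Ng | intros Z; rewrite Z in Hpos; lra ] |].
    transitivity (e * e * g u); [ rewrite Hee |]; ring. }
assert (P : ((s v - c * RtoC (rho v)) * (s v + c * RtoC (rho v)))%C = RtoC 0).
{ transitivity (s v * s v - c * c * (RtoC (rho v) * RtoC (rho v)))%C; [ ring |].
  rewrite Hsv, Ecc, <- RtoC_mult; unfold rho; rewrite sqrt_sqrt by lra.
  rewrite <- RtoC_mult, <- RtoC_minus; f_equal; fold (g v).
  transitivity (g v - e * e * g v); [ ring | rewrite Hee; ring ]. }
transitivity ((s v - c * RtoC (rho v)) * (s v + c * RtoC (rho v))
  / (s v + c * RtoC (rho v)) + c * RtoC (rho v))%C; [ field; exact Sv |].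
rewrite P; field; exact Sv.
Qed.

(** Since r^2 = e u1^3 u2^3, the logarithmic derivative of r in u_i is 3 / (2 u_i). *)
Lemma root_differential (e : R) (u p : plane) :
  0 < e * (fst u ^ 3 * snd u ^ 3) ->
  let r := sqrt (e * (fst u ^ 3 * snd u ^ 3)) in
  has_differential (fun z => sqrt (e * (fst (fst z) ^ 3 * snd (fst z) ^ 3)))
    (u, p) ((3 * r / (2 * fst u), 3 * r / (2 * snd u)), (0, 0)).
Proof.
intros Hpos r x1 x2 y1 y2 t v Hv E.
injection E as <- _; cbn [fst snd] in *.
destruct (is_velocity_Derive _ _ _ _ _ _ Hv) as [(X1 & X2 & _) (E1 & E2 & _)].
assert (N1 : x1 t <> 0)
  by (intros E; rewrite E in Hpos; ring_simplify in Hpos; lra).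
assert (N2 : x2 t <> 0)
  by (intros E; rewrite E in Hpos; ring_simplify in Hpos; lra).
pose proof (sqrt_lt_R0 _ Hpos) as Hr; fold r in Hr.
pose proof (pow2_sqrt _ (Rlt_le _ _ Hpos)) as Er; fold r in Er.
auto_derive; [ repeat split; auto; simpl in Hpos; lra |].
change (fun x => x1 x) with x1; change (fun x => x2 x) with x2.
rewrite E1, E2; unfold pairing; cbn [fst snd].
fold r.
match goal with |- ?a = ?b => change (@eq R a b) end.
match goal with |- context [sqrt ?a] => change (sqrt a) with r end.
clearbody r; field [Er]; lra.
Qed.

Theorem mainTheorem8 :
  (forall (D : plane -> Prop) (s : plane -> C),
     (forall u, D u -> off_diagonal u) ->
     is_branch_3_2 D s ->
     integrable_by_cubic D (geodesic_hamiltonian (metric 3 3)) (K3 3 s)) /\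
  integrable_by_cubic off_diagonal
    (geodesic_hamiltonian (metric 3 4))
    (K3 4 (fun u => RtoC (fst u ^ 2 * snd u ^ 2))) /\
  integrable_by_cubic off_diagonal
    (geodesic_hamiltonian (metric 2 1)) (K2 1).
Proof.
split; [| split].
- intros D s Hoff Hs; apply K3_integrable; auto; [ apply Hs |].
  intros u Hu.
  destruct (branch_local_form D s u Hs Hu) as (c & e & Hc & Hpos & Hl).
  destruct (proj2 Hs u Hu) as (N1 & N2 & _).
  exists c, (fun v => sqrt (e * (fst v ^ 3 * snd v ^ 3))).
  eexists; eexists; split; [ exact Hl |].
  split; [ intros p; apply (root_differential e u p Hpos) |].
  split; [| split; [| split; [ exact Hc |]]].
  + simpl INR; field; exact N1.
  + simpl INR; field; exact N2.
  + intros _ _; apply Rgt_not_eq, sqrt_lt_R0, Hpos.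
- apply K3_integrable; auto using open_off_diagonal.
  intros u _.
  (* For m = 4 the weight is the polynomial u1^2 u2^2, real on the whole domain; the last two
     witnesses are its partial derivatives. *)
  exists (RtoC 1), (fun v => fst v ^ 2 * snd v ^ 2),
    (2 * fst u * snd u ^ 2), (2 * fst u ^ 2 * snd u).
  split; [| split; [| split; [| split; [| split]]]].
  + apply filter_forall; intros v; ring.
  + intros p x1 x2 y1 y2 t v Hv E.
    injection E as <- _; cbn [fst snd] in *.
    destruct (is_velocity_Derive _ _ _ _ _ _ Hv) as [(X1 & X2 & _) (E1 & E2 & _)].
    auto_derive; [ auto |].
    change (fun x => x1 x) with x1; change (fun x => x2 x) with x2.
    rewrite E1, E2; unfold pairing; cbn [fst snd].
    match goal with |- ?a = ?b => change (@eq R a b) end; simpl; ring.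
  + simpl; ring.
  + simpl; ring.
  + apply RtoC_neq; lra.
  + intros N1 N2; apply Rmult_integral_contrapositive; split;
      apply pow_nonzero; assumption.
- split; [| split; [ apply homogeneous_common_factor |]; apply K2_factor ].
  apply (integrable_parabolic_criterion off_diagonal 2 M2);
    auto using M2_cubic, open_off_diagonal; [ lra |].
  intros z Hz.
  exists (RtoC 1), (RtoC 1), (dT 2 1 z), (dK2 z).
  split; [| split; [| split]].
  + apply T_Cdifferential, Hz.
  + apply K2_Cdifferential, Hz.
  + apply poisson_T_K2, Hz.
  + intros _ HM; split; [| split]; auto; apply RtoC_neq; lra.
Qed.
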